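(* Assume there exists $Q^\dagger\ge 0$ such that $D(1/\epsilon)=M\exp(-1)\le f(Q)$ for all $Q\ge Q^\dagger$, that $C(Q)$ is strictly increasing for all $Q\ge Q^\dagger$ with $\lim_{Q\to\infty}C(Q)=+\infty$, and that $C(Q^\dagger)\le \frac{M\exp(-1)}{\epsilon}e(Q^\dagger)$. Let $Q^*\ge Q^\dagger$ be the long-run capacity limit, i.e. the unique $Q\ge Q^\dagger$ with $C(Q)=\frac{M\exp(-1)}{\epsilon}e(Q)$ (equivalently, with zero optimal expansion, $q^*(Q)=0$). Then the grid emissions intensity satisfies $e(Q^* )>0$.
   Context: Constants: $M>0$, $\epsilon>0$, $k>0$. Real-valued functions of the renewable capacity $Q\ge 0$: emissions intensity $e(Q)\ge 0$ with $e'(Q)<0$; delivered renewable electricity $f(Q)\ge 0$ with $f(0)=0$, $f'(Q)>0$, $f''(Q)<0$; marginal wholesale value $\pi(Q)$ with $\pi'(Q)<0$; costs $C_R(Q)\ge 0$, $C_S(Q)\ge 0$, assumed continuous. Demand is $D(x)=M\exp(-\epsilon x)$; integrated non-investment cost is $C(Q)=C_S(Q)+C_R(Q)-f(Q)\pi(Q)$. For $Q\ge Q^\dagger$ the optimal price is $p^*(Q)=e(Q)/\epsilon$, the resulting revenue is $R(Q)=\frac{M\exp(-1)}{\epsilon}e(Q)$ (equal to $0$ if $e(Q)=0$), and the optimal single-period expansion is $q^*(Q)=(R(Q)-C(Q))/k$. *)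

(* Defs.v *)
(* Stdlib reals, with Coquelicot for limits at infinity. *)
From Stdlib Require Import Reals.
From Coquelicot Require Import Coquelicot.
Open Scope R_scope.

(* Capacities range over [0, +oo). The model's functions are total functions on
   R, but only their values at nonnegative capacities are ever constrained. *)
Definition capacity (Q : R) : Prop := 0 <= Q.

(* Derivative relative to the half-line [0, +oo): two-sided at Q > 0 and
   one-sided (from the right) at Q = 0. *)
Definition is_derivative (g g' : R -> R) : Prop :=
  forall Q, capacity Q -> D_in g g' capacity Q.

Definition continuous_on_capacities (g : R -> R) : Prop :=
  forall Q, capacity Q -> continue_in g capacity Q.

Definition demand (M eps x : R) : R := M * exp (- eps * x).

Definition net_cost (f pi C_R C_S : R -> R) (Q : R) : R :=
  C_S Q + C_R Q - f Q * pi Q.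

(* Revenue at the optimal price e(Q)/eps; it vanishes when e(Q) = 0. *)
Definition revenue (M eps : R) (e : R -> R) (Q : R) : R :=
  M * exp (-1) / eps * e Q.

Definition expansion (M eps k : R) (e C : R -> R) (Q : R) : R :=
  (revenue M eps e Q - C Q) / k.

(* Main.v *)
(* Revenue is a positive multiple of the strictly decreasing e, whereas the net
   cost C strictly increases to +oo from a value below the revenue: the two
   curves cross exactly once. At the crossing e cannot vanish, since e >= 0 is
   strictly decreasing. *)
Require Import Defs.
From Stdlib Require Import Reals Lra.
From Coquelicot Require Import Coquelicot.
Open Scope R_scope.

(* Continuous extension from [0, +oo) to R: the interval theorems of the
   libraries require two-sided continuity, which may fail at Q = 0. *)
Definition extend (g : R -> R) (x : R) : R := g (Rmax 0 x).

Lemma extend_capacity (g : R -> R) (x : R) : capacity x -> extend g x = g x.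
Proof. intros Hx. unfold extend. now rewrite Rmax_right. Qed.

Lemma Rmax_0_contraction (x y : R) : Rabs (Rmax 0 y - Rmax 0 x) <= Rabs (y - x).
Proof.
unfold Rmax.
destruct (Rle_dec 0 x), (Rle_dec 0 y); unfold Rabs; repeat destruct Rcase_abs; lra.
Qed.

Lemma continuity_extend (g : R -> R) :
  continuous_on_capacities g -> continuity (extend g).
Proof.
intros Hg x eps Heps.
destruct (Hg (Rmax 0 x) (Rmax_l 0 x) eps Heps) as [d [Hd H]].
exists d; split; [exact Hd|].
intros y [_ Hy]; simpl in *; unfold Rdist, extend in *.
(* [continue_in] only controls points distinct from the base point, and distinct [x], [y] may be
   clamped to the same capacity 0; that case is settled by itself. *)
destruct (Req_dec (Rmax 0 x) (Rmax 0 y)) as [E|E].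
- rewrite E, Rminus_diag, Rabs_R0; exact Heps.
- apply H; split.
  + split; [apply Rmax_l | exact E].
  + apply Rle_lt_trans with (2 := Hy); apply Rmax_0_contraction.
Qed.

Lemma is_derivative_continuous (g g' : R -> R) :
  is_derivative g g' -> continuous_on_capacities g.
Proof. intros D Q HQ. exact (cont_deriv g g' capacity Q (D Q HQ)). Qed.

Lemma is_derive_extend (g g' : R -> R) (x : R) :
  is_derivative g g' -> 0 < x -> is_derive (extend g) x (g' x).
Proof.
intros D Hx; apply is_derive_Reals; intros eps Heps.
destruct (D x (Rlt_le _ _ Hx) eps Heps) as [d [Hd H]].
(* Capping the radius by [x] keeps [x + h] positive, where [extend g] agrees with [g]. *)
assert (Hm : 0 < Rmin d x) by now apply Rmin_glb_lt.
exists (mkposreal _ Hm); simpl; intros h Hh0 Hh.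
pose proof (Rmin_l d x); pose proof (Rmin_r d x).
assert (Hxh : 0 < x + h) by (apply Rabs_def2 in Hh; lra).
rewrite !extend_capacity by (unfold capacity; lra).
specialize (H (x + h)); simpl in H; unfold Rdist in H.
replace (x + h - x) with h in H by ring.
apply H; repeat split; unfold capacity; lra.
Qed.

(** Mean value theorem for [extend g]: the derivative is required only strictly between [a] and [b],
    so [a = 0] is allowed, continuity being enough there. *)
Lemma negative_derivative_decreasing (g g' : R -> R) (a b : R) :
  is_derivative g g' -> (forall Q, capacity Q -> g' Q < 0) ->
  0 <= a -> a < b -> g b < g a.
Proof.
intros D Hneg Ha Hab.
destruct (MVT_gen (extend g) a b g') as [c [Hc E]];
  rewrite ?Rmin_left, ?Rmax_right in * by lra.
- intros x Hx; apply is_derive_extend; [exact D | lra].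
- intros x _; exact (continuity_extend g (is_derivative_continuous g g' D) x).
- rewrite !extend_capacity in E by (unfold capacity; lra).
  assert (Hgc : g' c < 0) by (apply Hneg; unfold capacity; lra).
  assert (0 < - g' c * (b - a)) by (apply Rmult_lt_0_compat; lra).
  lra.
Qed.

Lemma continuous_net_cost (f pi C_R C_S : R -> R) :
  continuous_on_capacities f -> continuous_on_capacities pi ->
  continuous_on_capacities C_R -> continuous_on_capacities C_S ->
  continuity (extend (net_cost f pi C_R C_S)).
Proof.
intros Hf Hpi HR HS.
(* [extend] commutes with pointwise operations by mere unfolding. *)
apply (continuity_minus (extend C_S + extend C_R)%F (extend f * extend pi)%F).
- apply continuity_plus; now apply continuity_extend.
- apply continuity_mult; now apply continuity_extend.
Qed.

(** Intermediate value theorem for [g - h]: it is nonpositive at [a], and positive far out because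
    [g] eventually exceeds [h a], which bounds [h] on the whole half-line. *)
Lemma crossing_exists (g h : R -> R) (a : R) :
  0 <= a -> continuity (extend g) -> continuity (extend h) ->
  (forall x, a <= x -> h x <= h a) ->
  is_lim g p_infty p_infty -> g a <= h a ->
  exists x, a <= x /\ g x = h x.
Proof.
intros Ha Cg Ch Hh Hlim Hga.
apply is_lim_spec in Hlim; destruct (Hlim (h a)) as [N HN].
(* A point beyond [a] and strictly beyond the threshold [N] past which [g] stays above [h a]. *)
pose (b := Rmax a N + 1).
assert (Hb : a <= b /\ N < b)
  by (unfold b; pose proof (Rmax_l a N); pose proof (Rmax_r a N); lra).
pose proof (HN b (proj2 Hb)); pose proof (Hh b (proj1 Hb)).
destruct (IVT_cor (extend g - extend h)%F a b) as [x [Hx E]].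
- now apply continuity_minus.
- exact (proj1 Hb).
- unfold minus_fct; rewrite !extend_capacity by (unfold capacity; lra).
  assert (0 <= (h a - g a) * (g b - h b)) by (apply Rmult_le_pos; lra).
  lra.
- exists x; split; [exact (proj1 Hx)|].
  unfold minus_fct in E; rewrite !extend_capacity in E by (unfold capacity; lra).
  lra.
Qed.

Theorem proposition2
  (M eps k : R) (HM : 0 < M) (Heps : 0 < eps) (Hk : 0 < k)
  (e e' f f' f'' pi pi' C_R C_S : R -> R)
  (He : forall Q, capacity Q -> 0 <= e Q)
  (De : is_derivative e e')
  (He' : forall Q, capacity Q -> e' Q < 0)
  (Hf : forall Q, capacity Q -> 0 <= f Q)
  (Hf0 : f 0 = 0)
  (Df : is_derivative f f')
  (Hf' : forall Q, capacity Q -> 0 < f' Q)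
  (Df' : is_derivative f' f'')
  (Hf'' : forall Q, capacity Q -> f'' Q < 0)
  (Dpi : is_derivative pi pi')
  (Hpi' : forall Q, capacity Q -> pi' Q < 0)
  (HCR : forall Q, capacity Q -> 0 <= C_R Q)
  (CCR : continuous_on_capacities C_R)
  (HCS : forall Q, capacity Q -> 0 <= C_S Q)
  (CCS : continuous_on_capacities C_S)
  (Qd : R) (HQd : 0 <= Qd)
  (Hsupply : forall Q, Qd <= Q -> demand M eps (1 / eps) <= f Q)
  (Hincr : forall Q1 Q2, Qd <= Q1 -> Q1 < Q2 ->
     net_cost f pi C_R C_S Q1 < net_cost f pi C_R C_S Q2)
  (Hlim : is_lim (net_cost f pi C_R C_S) p_infty p_infty)
  (Hstart : net_cost f pi C_R C_S Qd <= M * exp (-1) / eps * e Qd) :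
  (exists! Q, Qd <= Q /\ net_cost f pi C_R C_S Q = M * exp (-1) / eps * e Q) /\
  (forall Q, Qd <= Q ->
     (net_cost f pi C_R C_S Q = M * exp (-1) / eps * e Q <->
      expansion M eps k e (net_cost f pi C_R C_S) Q = 0)) /\
  (forall Qs, Qd <= Qs ->
     net_cost f pi C_R C_S Qs = M * exp (-1) / eps * e Qs ->
     0 < e Qs).
Proof.
assert (Hc : 0 < M * exp (-1) / eps)
  by (apply Rdiv_lt_0_compat; [apply Rmult_lt_0_compat; [exact HM | apply exp_pos] | exact Heps]).
assert (Hdecr : forall a b, Qd <= a -> a < b ->
          M * exp (-1) / eps * e b < M * exp (-1) / eps * e a).
{ intros a b Ha Hab; apply Rmult_lt_compat_l; [exact Hc|].
  apply (negative_derivative_decreasing e e'); auto; lra. }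
repeat split.
- destruct (crossing_exists (net_cost f pi C_R C_S)
              (fun Q => M * exp (-1) / eps * e Q) Qd) as [Q [HQ E]]; auto.
  + apply continuous_net_cost; eauto using is_derivative_continuous.
  + apply (continuity_scal (extend e)), continuity_extend.
    exact (is_derivative_continuous e e' De).
  + intros x [Hx | <-]; [apply Rlt_le, Hdecr; lra | apply Rle_refl].
  + exists Q; split; [now split|].
    intros Q' [HQ' E'].
    (* Of two distinct crossings, the larger would have both higher cost and lower revenue. *)
    destruct (Rtotal_order Q Q') as [H | [H | H]]; [exfalso | exact H | exfalso].
    * pose proof (Hincr Q Q' HQ H); pose proof (Hdecr Q Q' HQ H); lra.
    * pose proof (Hincr Q' Q HQ' H); pose proof (Hdecr Q' Q HQ' H); lra.
- intros E; unfold expansion, revenue; rewrite E; field; lra.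
- unfold expansion, revenue; intros E.
  apply Rmult_integral in E; destruct E as [E | E]; [lra|].
  pose proof (Rinv_0_lt_compat k Hk); lra.
- intros Qs HQs _.
  (* Any capacity beyond [Qs] would serve as the point of comparison. *)
  apply Rle_lt_trans with (e (Qs + 1)).
  + apply He; unfold capacity; lra.
  + apply (negative_derivative_decreasing e e'); auto; lra.
Qed.
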